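(* Let $\mu$ be a Borel measure on $\mathbb{R}$ for which the following condition fails: for each $a\in[-\infty,\infty)$, there is $t>a$ such that $\mu_{\mathrm{sf}}((a,t))<\infty$. Let $f:\mathbb{R}\to\mathbb{R}$ be a function such that the inhomogeneous linear integral inequality $$y(t) \leq f(t) + \int_{(-\infty,t)} y \,\mathrm{d}\mu\quad\text{for }\mu\text{-a.e. }t \in \mathbb{R}$$ has at least one solution $y$. Then there is no real-valued function $b:\mathbb{R}\to\mathbb{R}$ such that every solution $y$ to this inequality satisfies $y \leq b$ $\mu$-a.e.
   Context: A Borel measure on $\mathbb{R}$ is any (countably additive) measure $\mu:\mathcal{B}(\mathbb{R})\to[0,\infty]$ on the Borel $\sigma$-algebra $\mathcal{B}(\mathbb{R})$ of $\mathbb{R}$ with its standard topology; no finiteness, local finiteness, $\sigma$-finiteness or semi-finiteness is assumed. The semi-finite part of $\mu$ is the measure $\mu_{\mathrm{sf}}:\mathcal{B}(\mathbb{R})\to[0,\infty]$ given by $\mu_{\mathrm{sf}}(E)=\sup\{\mu(E\cap F): F\in\mathcal{B}(\mathbb{R}),\ \mu(F)<\infty\}$. A solution to the integral inequality is a real-valued Borel function $y$ on $\mathbb{R}$ with $\int_{(-\infty,t)}|y|\,\mathrm{d}\mu<\infty$ for all $t\in\mathbb{R}$ that satisfies the inequality for $\mu$-a.e. $t$. A property holds $\mu$-a.e. if it holds outside some $\mu$-null Borel set. For $a=-\infty$, $(a,t)$ means $(-\infty,t)$. *)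

(* Defs.v *)
From HB Require Import structures.
From mathcomp Require Import all_boot all_order all_algebra.
From mathcomp Require Import all_classical all_reals all_analysis.

Set Implicit Arguments.
Unset Strict Implicit.
Unset Printing Implicit Defensive.

Import Order.TTheory GRing.Theory Num.Theory.
Import numFieldNormedType.Exports.

Local Open Scope classical_set_scope.
Local Open Scope ring_scope.
Local Open Scope ereal_scope.

(* [measurableTypeR R] is generated by the half-open intervals ]a, b]; open
   intervals generate the same sigma-algebra, so it is the Borel one. *)
Definition semifinite_part (R : realType)
    (mu : {measure set (measurableTypeR R) -> \bar R})
    (E : set (measurableTypeR R)) : \bar R :=
  ereal_sup [set mu (E `&` F) | F in [set F | measurable F /\ mu F < +oo]].

(* The interval (a, t) whose left endpoint may be -oo. *)
Definition eitvoo (R : realType) (a : \bar R) (t : R)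
    : set (measurableTypeR R) :=
  [set x : R | a < x%:E /\ (x < t)%R].

Definition locally_right_sf_finite (R : realType)
    (mu : {measure set (measurableTypeR R) -> \bar R}) : Prop :=
  forall a : \bar R, a < +oo ->
    exists t : R, a < t%:E /\ semifinite_part mu (eitvoo a t) < +oo.

(* [Rintegral] is the [fine] part of the extended integral, which is finite
   here by the integrability clause. *)
Definition integral_ineq_solution (R : realType)
    (mu : {measure set (measurableTypeR R) -> \bar R}) (f y : R -> R) : Prop :=
  [/\ measurable_fun [set: measurableTypeR R] (y : measurableTypeR R -> R),
      forall t : R, mu.-integrable `]-oo, t[ (EFin \o y) &
      {ae mu, forall t, (y t <= f t + \int[mu]_(s in `]-oo, t[) y s)%R}].

(* Main.v *)
(** Some [a] satisfies [mu_sf (a, t) = +oo] for all [t > a]. Since a set of finite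
    measure in [(a, t)] loses little mass when cut off close to [a], one finds
    Borel sets [E 0 > E 1 > ...] descending towards [a] with
    [1 < mu (E n) < +oo]. The function equal to [2^-n / mu (E n)] on [E n] and to
    [0] elsewhere is a nonnegative integrable solution [z] of the homogeneous
    inequality, because on [E n] the integral of [z] over the earlier times is at
    least [\sum_(k > n) 2^-k = 2^-n]. Hence [y + k z] is a solution for every
    solution [y] and every [k : nat], and these are unbounded on [E 0]. *)

Require Import Defs.
From HB Require Import structures.
From mathcomp Require Import all_boot all_order all_algebra.
From mathcomp Require Import all_classical all_reals all_analysis.
From mathcomp Require Import measurable_realfun.

Import Order.TTheory GRing.Theory Num.Theory.
Import numFieldNormedType.Exports.

Local Open Scope classical_set_scope.
Local Open Scope ring_scope.

Lemma measurable_eitvoo (R : realType) (a : \bar R) (t : R) :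
  measurable (eitvoo a t).
Proof.
case: a => [a| |].
- rewrite (_ : eitvoo _ _ = `]a, t[%classic); first exact: measurable_itv.
  by apply/seteqP; split => x /=; rewrite /eitvoo /= in_itv /= lte_fin => /andP.
- rewrite (_ : eitvoo _ _ = set0); first exact: measurable0.
  by rewrite -subset0 => x [].
- rewrite (_ : eitvoo _ _ = `]-oo, t[%classic); first exact: measurable_itv.
  apply/seteqP; split => x /=; rewrite /eitvoo /= in_itv /=; first by case.
  by move=> xt; rewrite ltNyr.
Qed.

(** Supplies cut-off points tending to [a], treating real [a] and [-oo] alike: [(a, t)] is the
    increasing union of the [[u n, t)]. *)
Lemma ereal_decreasing_approx (R : realType) (a : \bar R) : (a < +oo)%E ->
  exists u : nat -> R, [/\ forall n, (a < (u n)%:E)%E,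
    {homo u : m n / (m <= n)%N >-> n <= m} &
    forall x : R, (a < x%:E)%E -> exists n, u n <= x].
Proof.
case: a => [a| |] // _.
- exists (fun n => a + n.+1%:R^-1); split.
  + by move=> n; rewrite lte_fin ltrDl.
  + by move=> m n mn; rewrite lerD2l lef_pV2 ?posrE// ler_nat.
  + move=> x; rewrite lte_fin => ax.
    have [n nx] := ltr_add_invr ax.
    by exists n; exact: ltW.
- exists (fun n => - n%:R); split => //.
  + by move=> n; rewrite ltNyr.
  + by move=> m n mn; rewrite lerN2 ler_nat.
  + move=> x _; exists (Num.bound `|x|).
    by rewrite lerNl (le_trans (ler_norm _))// normrN ltW// archi_boundP.
Qed.

(** The infinite supremum yields [F] of finite measure whose trace on [(a, t)] has measure above 1;
    by continuity from below, so has its part right of some [s > a]. This [s] can then serve as the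
    next right endpoint. *)
Lemma exists_finite_piece (R : realType)
    (mu : {measure set (measurableTypeR R) -> \bar R}) (a : \bar R) (t : R) :
  (a < +oo)%E -> semifinite_part mu (eitvoo a t) = +oo%E ->
  exists (s : R) (E : set R), [/\ (a < s%:E)%E,
    measurable (E : set (measurableTypeR R)), (mu E < +oo)%E, (1 < mu E)%E &
    forall x, E x -> s <= x /\ x < t].
Proof.
move=> aoo sfoo.
have : (1%E < semifinite_part mu (eitvoo a t))%E by rewrite sfoo ltry.
move=> /ereal_sup_gt[_ [F [mF Foo] <-]].
set G := _ `&` _ => G1.
have mG : measurable G by apply: measurableI => //; exact: measurable_eitvoo.
have [u [au u_dec u_lim]] := ereal_decreasing_approx _ _ aoo.
pose H n : set (measurableTypeR R) := G `&` `[u n, +oo[%classic.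
have mH n : measurable (H n) by apply: measurableI => //; exact: measurable_itv.
have HG : \bigcup_n H n = G.
  apply/seteqP; split => [x [n _ []]//|x Gx].
  have [n un] := u_lim x Gx.1.1.
  by exists n => //; split => //=; rewrite in_itv/= un.
have : mu \o H @ \oo --> mu G.
  rewrite -HG; apply: nondecreasing_cvg_mu => //; first by rewrite HG.
  move=> m n mn; apply/subsetPset => x [Gx /=]; rewrite !in_itv/= !andbT => umx.
  by split => //=; rewrite in_itv/= andbT (le_trans _ umx)// u_dec.
move=> cH.
(* Otherwise every [mu (H n)] is at most 1, and so is the limit [mu G]. *)
have [n n1] : exists n, (1 < mu (H n))%E.
  apply: contrapT => /forallNP nH; move: G1; apply/negP; rewrite -leNgt.
  rewrite -(cvg_lim _ cH)//; apply: lime_le.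
    by apply/cvg_ex; exists (mu G).
  by apply: nearW => n; rewrite leNgt; apply/negP; exact: nH.
exists (u n), (H n); split => //.
- apply: le_lt_trans Foo; apply: le_measure; rewrite ?inE// => x [[_]]//.
- by move=> x [[[_ xt] _]] /=; rewrite in_itv/= andbT.
Qed.

Lemma exists_descending_pieces (R : realType)
    (mu : {measure set (measurableTypeR R) -> \bar R}) :
  ~ locally_right_sf_finite mu ->
  exists E : nat -> set (measurableTypeR R), [/\
    forall n, measurable (E n), forall n, (mu (E n) < +oo)%E,
    forall n, (1 < mu (E n))%E &
    forall m n x y, (m < n)%N -> E m x -> E n y -> (y : R) < x].
Proof.
move=> /existsNP[a /not_implyP[aoo /forallNP sfoo]].
have {}sfoo t : (a < t%:E)%E -> semifinite_part mu (eitvoo a t) = +oo%E.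
  move=> at_; have /not_andP[//|/negP] := sfoo t.
  by rewrite -leNgt leye_eq => /eqP.
(* Choice needs a value for every real [t]; for [t] not above [a] the pair [(t, set0)] is a
   dummy. *)
have /choice[p pP] : forall t, exists p : R * set R, (a < t%:E)%E ->
    [/\ (a < p.1%:E)%E, measurable (p.2 : set (measurableTypeR R)),
     (mu p.2 < +oo)%E, (1 < mu p.2)%E & forall x, p.2 x -> p.1 <= x /\ x < t].
  move=> t; have [at_|] := pselect (a < t%:E)%E; last by exists (t, set0).
  by have [s [E ?]] := exists_finite_piece _ mu a t aoo (sfoo t at_); exists (s, E).
have [u [au _ _]] := ereal_decreasing_approx _ _ aoo.
pose t n := iter n (fun s => (p s).1) (u 0%N).
have at_ n : (a < (t n)%:E)%E.
  by elim: n => [|n /pP[]//]; exact: au.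
have E_lb n x : (p (t n)).2 x -> t n.+1 <= x.
  by have [_ _ _ _ /[apply] -[]] := pP _ (at_ n).
have E_ub n x : (p (t n)).2 x -> x < t n.
  by have [_ _ _ _ /[apply] -[]] := pP _ (at_ n).
have E_n0 n : (p (t n)).2 !=set0.
  apply/set0P/eqP => p0; have [_ _ _] := pP _ (at_ n).
  by rewrite p0 measure0 lte_fin ltr10.
(* Any point of the [n]-th piece lies in [[t n.+1, t n)], which forces [t n.+1 < t n]. *)
have t_dec m n : (m <= n)%N -> t n <= t m.
  apply: (@homo_leq _ t (fun x y => y <= x)) => //.
  - by move=> x y z xy yz; exact: le_trans yz xy.
  - move=> k; have [x Ex] := E_n0 k.
    by rewrite (le_trans (E_lb _ _ Ex))// ltW// E_ub.
exists (fun n => (p (t n)).2); split => [n|n|n|m n x y mn Ex Ey].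
- by have [] := pP _ (at_ n).
- by have [] := pP _ (at_ n).
- by have [] := pP _ (at_ n).
- by rewrite (lt_le_trans (E_ub _ _ Ey))// (le_trans (t_dec _ _ mn))// E_lb.
Qed.

Lemma exists_homogeneous_subsolution (R : realType)
    (mu : {measure set (measurableTypeR R) -> \bar R})
    (E : nat -> set (measurableTypeR R)) :
  (forall n, measurable (E n)) -> (forall n, (mu (E n) < +oo)%E) ->
  (forall n, (1 < mu (E n))%E) ->
  (forall m n x y, (m < n)%N -> E m x -> E n y -> (y : R) < x) ->
  exists z : R -> R, [/\
    measurable_fun [set: measurableTypeR R] (z : measurableTypeR R -> R),
    mu.-integrable setT (EFin \o z),
    forall t, z t <= \int[mu]_(s in `]-oo, t[) z s &
    forall t, E 0 t -> 0 < z t].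
Proof.
move=> mE Eoo E1 Edec.
pose m n := fine (mu (E n)).
have muE n : mu (E n) = (m n)%:E.
  by rewrite /m fineK// ge0_fin_numE.
have m1 n : 1 < m n by rewrite -lte_fin -muE.
have m0 n : 0 < m n by rewrite (lt_trans _ (m1 n)).
(* This is [2^-n], in the shape of the geometric series used for [sumq]. *)
pose q n : R := 2 / (2 ^ n.+1)%:R.
have q0 n : 0 < q n by rewrite /q divr_gt0// ltr0n expn_gt0.
have qE n k : q (k + n)%N = 2 / (2 ^ (k + n.+1))%:R by rewrite /q addnS.
have sumq n : (\sum_(0 <= k <oo) (q (k + n)%N)%:E = (2 / 2 ^+ n)%:E)%E.
  under eq_eseriesr do rewrite qE.
  by apply/cvg_lim => //; exact: cvg_geometric_eseries_half.
pose c n := q n / m n.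
have c0 n : 0 < c n by rewrite divr_gt0.
(* Here [1 < mu (E n)] enters: the value of [z] on [E n] is at most its integral over [E n]. *)
have cq n : c n <= q n.
  by rewrite ler_pdivrMr// ler_peMr ?ltW.
pose h n x : \bar R := ((c n)%:E * (\1_(E n) x)%:E)%E.
have h0 n x : (0 <= h n x)%E.
  by rewrite mule_ge0// lee_fin// ltW.
have mh n (D : set (measurableTypeR R)) :
    measurable D -> measurable_fun D (h n : measurableTypeR R -> \bar R).
  move=> mD; apply: measurable_funeM; apply/measurable_EFinP.
  exact: measurable_indic.
pose zE (x : measurableTypeR R) := (\sum_(0 <= n <oo) h n x)%E.
(* The pieces are disjoint by [Edec], so only one term of the series survives. *)
have zE_in n x : E n x -> zE x = (c n)%:E.
  move=> Enx; rewrite /zE (@nneseriesD1 _ _ n)//.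
  rewrite /h indicE mem_set// mule1 eseries0 ?adde0// => k _ kn.
  rewrite indicE memNset ?mule0// => Ekx.
  move: kn; rewrite neq_ltn => /orP[kn|kn].
  - by have := Edec _ _ _ _ kn Ekx Enx; rewrite ltxx.
  - by have := Edec _ _ _ _ kn Enx Ekx; rewrite ltxx.
have zE_out x : (forall n, ~ E n x) -> zE x = 0%E.
  move=> nE; rewrite /zE eseries0// => k _ _.
  by rewrite /h indicE memNset ?mule0.
have zE_fin x : zE x \is a fin_num.
  have [[n /zE_in ->]//|/forallNP/zE_out ->//] := pselect (exists n, E n x).
have zE0 x : (0 <= zE x)%E by exact: nneseries_ge0.
have mzE : measurable_fun [set: measurableTypeR R]
    (zE : measurableTypeR R -> \bar R).
  by apply: (ge0_emeasurable_sum (P := predT)) => // k _; exact: mh.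
have inth (D : set (measurableTypeR R)) : measurable D ->
    (\int[mu]_(x in D) zE x = \sum_(0 <= n <oo) (c n)%:E * mu (E n `&` D))%E.
  move=> mD; rewrite /zE integral_nneseries//; last by move=> n; exact: mh.
  apply: eq_eseriesr => n _; rewrite /h ge0_integralZl_EFin ?integral_indic//.
  - by apply/measurable_EFinP; exact: measurable_indic.
  - exact: ltW.
have cm n : ((c n)%:E * mu (E n) = (q n)%:E)%E.
  by rewrite muE -EFinM divfK// gt_eqF.
have zEz : EFin \o (fine \o zE) = zE by apply/funext => x /=; rewrite fineK.
have izE : mu.-integrable setT zE.
  apply/integrableP; split => //.
  under eq_integral do rewrite gee0_abs//.
  rewrite inth//; under eq_eseriesr => n _ do rewrite setIT cm -[X in q X]addn0.
  by rewrite sumq ltry.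
exists (fine \o zE); split.
- exact: measurableT_comp.
- by rewrite zEz.
- move=> t; have mt : measurable (`]-oo, t[%classic : set (measurableTypeR R)).
    exact: measurable_itv.
  have izt : mu.-integrable `]-oo, t[ zE by exact: (@integrableS _ _ _ _ setT).
  have -> : \int[mu]_(s in `]-oo, t[) (fine \o zE) s =
      fine (\int[mu]_(s in `]-oo, t[) zE s)%E.
    by congr fine; apply: eq_integral => x _; exact: fineK.
  rewrite -lee_fin (fineK (integrable_fin_num mt izt)) /= fineK//.
  have [[n Ent]|/forallNP/zE_out ->] := pselect (exists n, E n t); last first.
    exact: integral_ge0.
  rewrite (zE_in n)// inth// (le_trans (y := (q n)%:E)) ?lee_fin//.
  have cE0 k : (0 <= (c k)%:E * mu (E k `&` `]-oo, t[%classic))%E.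
    by rewrite mule_ge0// lee_fin ltW.
  (* For [t] in [E n], the terms up to [n] are dropped. Each later piece lies wholly left of [t] and
     contributes its full [q k]; these sum to [2 / 2 ^+ n.+1], which is exactly [q n]. *)
  rewrite (nneseries_split 0%N n.+1)// add0n.
  apply: le_trans (leeDr _ _); last by rewrite sume_ge0.
  rewrite -(nneseries_addn n.+1)// (_ : q n = 2 / 2 ^+ n.+1) ?natrX -?sumq//.
    apply: lee_nneseries => [k _ _|k _]; first by rewrite lee_fin ltW.
    rewrite setIidl ?cm// => x Ex /=; rewrite in_itv/=.
    by apply: Edec Ent Ex; exact: leq_addl.
  by rewrite /q natrX.
- by move=> t E0t /=; rewrite (zE_in 0%N)//=.
Qed.

Theorem mainTheorem3 (R : realType)
    (mu : {measure set (measurableTypeR R) -> \bar R})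
    (hmu : ~ locally_right_sf_finite mu)
    (f : R -> R)
    (hf : exists y : R -> R, integral_ineq_solution mu f y) :
  ~ exists b : R -> R, forall y : R -> R,
      integral_ineq_solution mu f y -> {ae mu, forall t, y t <= b t}.
Proof.
have [E [mE Eoo E1 Edec]] := exists_descending_pieces _ _ hmu.
have [z [mz iz zle z0]] := exists_homogeneous_subsolution _ _ _ mE Eoo E1 Edec.
case: hf => y [my iy yle] [b bP].
have mt t : measurable (`]-oo, t[%classic : set (measurableTypeR R)).
  exact: measurable_itv.
have izt t : mu.-integrable `]-oo, t[ (EFin \o z).
  exact: (@integrableS _ _ _ _ setT).
have sol (k : nat) : integral_ineq_solution mu f (fun t => y t + k%:R * z t).
  have ikz t : mu.-integrable `]-oo, t[ (EFin \o (fun t => k%:R * z t)).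
    exact: (integrableZl (mt t) k%:R (izt t)).
  split.
  - by apply: measurable_funD => //; apply: measurable_funM.
  - by move=> t; exact: (integrableD (mt t) (iy t) (ikz t)).
  (* The inequality for [z] holds at every [t], so the exceptional set of [y] serves for all [k]. *)
  - apply: (@filterS _ _ (ae_filter_ringOfSetsType mu)) yle => t yt.
    rewrite RintegralD// RintegralZl// addrA lerD// ler_wpM2l//.
(* Countably many null sets merge into one null set [N], outside which [b] bounds all [y + k z] at
   once. *)
have /ae_foralln := fun k => bP _ (sol k).
move=> [N [mN N0 bN]].
have : (mu (E 0%N) <= mu N)%E.
  apply: le_measure; rewrite ?inE// => t E0t; apply: bN => /= bt.
  have zt := z0 _ E0t.
  (* This [k] makes [y t + k z t] exceed [b t], so all of [E 0] lies in [N], against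
     [mu (E 0) > 1]. *)
  pose k := Num.bound `|(b t - y t) / z t|.
  have := bt k; rewrite -lerBrDl -ler_pdivlMr// leNgt => /negP; apply.
  by rewrite (le_lt_trans (ler_norm _))// archi_boundP.
by apply/negP; rewrite -ltNge N0 (lt_trans _ (E1 0%N))// lte_fin.
Qed.
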